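(* Let $W$ be a discrete memoryless channel with finite input alphabet $\mathcal{X}$ and finite output alphabet $\mathcal{Y}$, and let $q:\mathcal{X}\times\mathcal{Y}\to\mathbb{R}$ be a decoding metric for which there exists $B\ge 0$, $B<\infty$, such that $q(x,y)\le B$ for all $(x,y)\in\mathcal{X}\times\mathcal{Y}$ and $q(x,y)\ge -B$ for all $(x,y)$ with $W(y|x)>0$. Then $$C_q^{(\infty)}(W)=C_{q,margin}^{const}(W).$$
   Context: $W(y|x)$ is a conditional p.m.f.; $W^n(y^n|x^n)=\prod_{i=1}^n W(y_i|x_i)$. The additive metric is $q_n(x^n,y^n)=\frac1n\sum_{i=1}^n q(x_i,y_i)$. Product-space random coding rate: for $k\ge1$, $$C_q^{(k)}(W)=\max_{P_{X^k}}\ \min_{P_{\widetilde Y^k|X^k}}\ \frac1k I(X^k;\widetilde Y^k),$$ where the max is over probability distributions $P_{X^k}$ on $\mathcal{X}^k$, $(X^k,Y^k)\sim P_{X^k}\times W^k$, $(X^k,\widetilde Y^k)\sim P_{X^k}\times P_{\widetilde Y^k|X^k}$, and the min is over conditional p.m.f.s $P_{\widetilde Y^k|X^k}$ (from $\mathcal{X}^k$ to $\mathcal{Y}^k$) such that the marginals satisfy $P_{\widetilde Y^k}=P_{Y^k}$ and $\mathbb{E}(q_k(X^k,\widetilde Y^k))\ge\mathbb{E}(q_k(X^k,Y^k))$. Logarithms are natural. Set $C_q^{(\infty)}(W)=\limsup_{k\to\infty}C_q^{(k)}(W)$. Margin decoding: a codebook $\mathcal{C}_n$ of length $n$ with $M$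 codewords is a list $x^n(1),\dots,x^n(M)\in\mathcal{X}^n$; messages are equiprobable and message $m$ is sent as $x^n(m)$ over $W^n$. The $q_n$-decoder with a $\delta$-margin, on output $y^n$, decides on message $i$ iff $q_n(x^n(i),y^n)\ge q_n(x^n(j),y^n)+\delta$ for all $j\ne i$; if no such $i$ exists an error is declared. $P_{margin}(W^n,\mathcal{C}_n,q_n,\delta)$ is the resulting average probability of error. A rate $R$ is $\epsilon$-achievable with $\delta$-margin decoding if for every $\gamma>0$ there is a sequence of codebooks $\{\mathcal{C}_n\}$ such that for all sufficiently large $n$, $\mathcal{C}_n$ has $M_n$ codewords with $\frac1n\log M_n\ge R-\gamma$ and $P_{margin}(W^n,\mathcal{C}_n,q_n,\delta)\le\epsilon$. $C_{q,margin}(W,\delta)$ is the supremum of rates that are $\epsilon$-achievable with $\delta$-margin decoding for all $0<\epsilon<1$, and $C_{q,margin}^{const}(W)=\sup_{\delta>0}C_{q,margin}(W,\delta)$. *)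

(* Defs.v *)
From HB Require Import structures.
From mathcomp Require Import all_boot all_order all_algebra.
From mathcomp Require Import all_classical all_reals all_analysis.

Set Implicit Arguments.
Unset Strict Implicit.
Unset Printing Implicit Defensive.

Import Order.TTheory GRing.Theory Num.Theory.
Import numFieldNormedType.Exports.

Local Open Scope classical_set_scope.
Local Open Scope ring_scope.

Section FiniteProbability.
Context {R : realType}.

Definition is_pmf (A : finType) (P : A -> R) : Prop :=
  (forall a, 0 <= P a) /\ \sum_a P a = 1.

(* [V a b] is V(b|a). *)
Definition is_cond_pmf (A B : finType) (V : A -> B -> R) : Prop :=
  forall a, is_pmf (V a).

Definition joint (A B : finType) (P : A -> R) (V : A -> B -> R) : A -> B -> R :=
  fun a b => P a * V a b.

Definition marginal1 (A B : finType) (J : A -> B -> R) : A -> R :=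
  fun a => \sum_b J a b.

Definition marginal2 (A B : finType) (J : A -> B -> R) : B -> R :=
  fun b => \sum_a J a b.

Definition expectation2 (A B : finType) (J : A -> B -> R) (f : A -> B -> R) : R :=
  \sum_a \sum_b J a b * f a b.

(* In nats. If J a b = 0 the term is 0 (the convention 0 log 0 = 0);
   if J a b > 0 then both marginals are positive. *)
Definition mutual_info (A B : finType) (J : A -> B -> R) : R :=
  \sum_a \sum_b J a b * ln (J a b / (marginal1 J a * marginal2 J b)).

End FiniteProbability.

Section Channel.
Context {R : realType} {X Y : finType}.

(* [W x y] is W(y|x). *)
Definition memoryless (W : X -> Y -> R) (n : nat) :
    {ffun 'I_n -> X} -> {ffun 'I_n -> Y} -> R :=
  fun x y => \prod_(i < n) W (x i) (y i).

Definition additive_metric (q : X -> Y -> R) (n : nat) :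
    {ffun 'I_n -> X} -> {ffun 'I_n -> Y} -> R :=
  fun x y => n%:R^-1 * \sum_(i < n) q (x i) (y i).

Definition feasible (W q : X -> Y -> R) (k : nat)
    (P : {ffun 'I_k -> X} -> R)
    (V : {ffun 'I_k -> X} -> {ffun 'I_k -> Y} -> R) : Prop :=
  [/\ is_cond_pmf V,
      forall y, marginal2 (joint P V) y
                = marginal2 (joint P (@memoryless W k)) y
    & expectation2 (joint P (@memoryless W k)) (@additive_metric q k)
      <= expectation2 (joint P V) (@additive_metric q k)].

(* C_q^(k)(W) for k >= 1. The max and the min are written as extrema in the
   extended reals; by compactness both are attained when W is a channel and X
   is nonempty. At k = 0 the value is a dummy. *)
Definition product_rate (W q : X -> Y -> R) (k : nat) : \bar R :=
  ereal_sup [set ereal_inf [set (k%:R^-1 * mutual_info (joint P V))%:E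
                           | V in [set V | feasible W q P V]]
            | P in [set P : {ffun 'I_k -> X} -> R | is_pmf P]].

Definition product_rate_infty (W q : X -> Y -> R) : \bar R :=
  limn_esup (product_rate W q).

(* For delta > 0 at most one message satisfies the condition, so the choice made
   by [pick] is immaterial; [None] is a declared error. *)
Definition margin_decoder (n M : nat)
    (q : {ffun 'I_n -> X} -> {ffun 'I_n -> Y} -> R)
    (c : 'I_M -> {ffun 'I_n -> X}) (delta : R) (y : {ffun 'I_n -> Y}) :
    option 'I_M :=
  [pick i | [forall j, (j != i) ==> (q (c j) y + delta <= q (c i) y)]].

Definition P_margin (n M : nat)
    (W : {ffun 'I_n -> X} -> {ffun 'I_n -> Y} -> R)
    (c : 'I_M -> {ffun 'I_n -> X})
    (q : {ffun 'I_n -> X} -> {ffun 'I_n -> Y} -> R) (delta : R) : R :=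
  M%:R^-1 * \sum_(m < M) \sum_(y | margin_decoder q c delta y != Some m)
              W (c m) y.

(* Codebooks are nonempty: [0 < M n] excludes [ln 0 = 0]. *)
Definition achievable_margin (W q : X -> Y -> R) (delta eps r : R) : Prop :=
  forall gamma : R, 0 < gamma ->
  exists (M : nat -> nat) (c : forall n, 'I_(M n) -> {ffun 'I_n -> X}),
    \forall n \near \oo,
      [/\ (0 < M n)%N,
          r - gamma <= n%:R^-1 * ln ((M n)%:R : R)
        & P_margin (@memoryless W n) (c n) (@additive_metric q n) delta <= eps].

Definition margin_capacity (W q : X -> Y -> R) (delta : R) : \bar R :=
  ereal_sup [set r%:E | r in
    [set r : R | forall eps : R, 0 < eps < 1 -> achievable_margin W q delta eps r]].

Definition margin_capacity_const (W q : X -> Y -> R) : \bar R :=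
  ereal_sup [set margin_capacity W q delta | delta in [set delta : R | 0 < delta]].

End Channel.

(* Main.v *)
Require Import Defs.
From HB Require Import structures.
From mathcomp Require Import all_boot all_order all_algebra.
From mathcomp Require Import all_classical all_reals all_analysis.
From mathcomp Require Import ring lra.

Set Implicit Arguments.
Unset Strict Implicit.
Unset Printing Implicit Defensive.

Import Order.TTheory GRing.Theory Num.Theory.
Import numFieldNormedType.Exports.
Local Open Scope classical_set_scope.
Local Open Scope ring_scope.

(** Converse. Let the input be uniform on a codebook with margin error at most
    eps. A feasible V has the output law of the channel, so the expected score of
    the decoded codeword is the same for both; feasibility then bounds the loss
    incurred by V-pairs in which the input is not the decoded codeword by
    2 B eps, and each such pair loses at least delta. Hence under V the input is
    decoded correctly except with probability eps + 2 B eps / delta, and a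
    Fano-type bound gives I >= (1 - eps') ln M - ln 2.

    Achievability. Fix k and treat X^k as a single alphabet. Since relative
    entropy is continuous and the simplex compact, the strict inequality s < I on
    the feasible set survives a relaxation of all constraints by some eta > 0;
    this slack in the metric constraint is what pays for a margin of order eta.
    Codewords are drawn i.i.d. from P, conditioned on being typical. A wrong
    codeword that comes within the margin has a joint type with the output in
    the relaxed feasible set, which by the method of types has probability at
    most (n+1)^d exp(-n s). Block lengths that are not multiples of k are reached
    by padding with a fixed letter. *)

(** * Product distributions and the law of large numbers *)

Section Products.
Context {R : realType}.

Definition iid (A : finType) (n : nat) (p : A -> R) : {ffun 'I_n -> A} -> R :=
  fun x => \prod_(i < n) p (x i).

Lemma iid_ge0 (A : finType) (n : nat) (p : A -> R) (x : {ffun 'I_n -> A}) :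
  (forall a, 0 <= p a) -> 0 <= iid p x.
Proof. by move=> p0; apply: prodr_ge0. Qed.

Lemma sum_prod_pmf (I A : finType) (p : I -> A -> R) :
  (forall i, \sum_a p i a = 1) -> \sum_(x : {ffun I -> A}) \prod_i p i (x i) = 1.
Proof.
by move=> p1; rewrite -(bigA_distr_bigA (fun i a => p i a)); apply: big1 => i _.
Qed.

Lemma is_pmf_iid (A : finType) (n : nat) (p : A -> R) :
  is_pmf p -> is_pmf (@iid A n p).
Proof.
move=> [p0 p1]; split=> [x|]; first exact: iid_ge0.
exact: (sum_prod_pmf (p := fun _ : 'I_n => p)).
Qed.

Lemma is_cond_pmf_memoryless (A B : finType) (V : A -> B -> R) n :
  is_cond_pmf V -> is_cond_pmf (@memoryless R A B V n).
Proof.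
move=> hV x; split=> [y|].
  by apply: prodr_ge0 => i _; have [+ _] := hV (x i).
by apply: (sum_prod_pmf (p := fun i => V (x i))) => i; have [_ +] := hV (x i).
Qed.

Lemma sum_indic (A : finType) (a : A) (f : A -> R) :
  \sum_b (a == b)%:R * f b = f a.
Proof.
rewrite (bigD1 a)//= eqxx mul1r big1 ?addr0// => b /negbTE ba.
by rewrite eq_sym ba mul0r.
Qed.


Lemma sum_iid_coord (A I : finType) (p : A -> R) (j : I) (h : A -> R) :
  \sum_a p a = 1 ->
  \sum_(z : {ffun I -> A}) (\prod_i p (z i)) * h (z j) = \sum_a p a * h a.
Proof.
move=> p1; pose F i a := p a * (if i == j then h a else 1).
transitivity (\sum_(z : {ffun I -> A}) \prod_i F i (z i)).
  apply: eq_bigr => z _; rewrite big_split/=; congr (_ * _).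
  by rewrite -big_mkcond/= big_pred1_eq.
rewrite -(bigA_distr_bigA F) (bigD1 j)//= [X in _ * X]big1 ?mulr1.
  by apply: eq_bigr => a _; rewrite /F eqxx.
move=> i /negbTE ij; rewrite -p1; apply: eq_bigr => a _.
by rewrite /F ij mulr1.
Qed.

(** An indicator pinning coordinate [j] to a value [c] makes the summand a product over coordinates
    again; summing over [c] undoes it. *)
Lemma sum_iid_coord2 (A I : finType) (p : A -> R) (j l : I) (h : A -> A -> R) :
  \sum_a p a = 1 -> j != l ->
  \sum_(z : {ffun I -> A}) (\prod_i p (z i)) * h (z j) (z l)
  = \sum_a \sum_b p a * p b * h a b.
Proof.
move=> p1 jl; pose F c i a :=
  p a * (if i == j then (c == a)%:R else 1) * (if i == l then h c a else 1).
transitivity (\sum_c \sum_(z : {ffun I -> A}) \prod_i F c i (z i)).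
  rewrite exchange_big/=; apply: eq_bigr => z _.
  rewrite -(sum_indic (z j) (fun c => h c (z l))) big_distrr/=.
  apply: eq_bigr => c _; rewrite !big_split/= -mulrA; congr (_ * _).
  by rewrite -!big_mkcond/= !big_pred1_eq eq_sym.
apply: eq_bigr => c _; rewrite -(bigA_distr_bigA (F c)).
rewrite (bigD1 j)//= (bigD1 l) 1?eq_sym//= [X in _ * (_ * X)]big1 ?mulr1.
  rewrite (_ : \sum_a F c j a = p c).
    rewrite big_distrr/=; apply: eq_bigr => a _.
    by rewrite /F [l == j]eq_sym (negbTE jl) eqxx mulr1 mulrA.
  rewrite -[RHS](sum_indic c p); apply: eq_bigr => a _.
  by rewrite /F eqxx (negbTE jl) mulr1 mulrC.
move=> i /andP[/negbTE ij /negbTE il]; rewrite -p1; apply: eq_bigr => a _.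
by rewrite /F ij il !mulr1.
Qed.

Lemma chebyshev_iid (A : finType) (p : A -> R) (f : A -> R) (n : nat) (eta : R) :
  is_pmf p -> 0 < eta -> (0 < n)%N ->
  \sum_(z : {ffun 'I_n -> A}
     | eta < `|n%:R^-1 * (\sum_i f (z i)) - \sum_a p a * f a|) iid p z
  <= n%:R^-1 * (eta ^- 2 * \sum_a p a * (f a - \sum_b p b * f b) ^+ 2).
Proof.
move=> [p0 p1] eta0 n0; set mu := \sum_a p a * f a.
pose g a := f a - mu.
have n0R : 0 < n%:R :> R by rewrite ltr0n.
have gsum : \sum_a p a * g a = 0.
  rewrite /g; under eq_bigr do rewrite mulrBr.
  by rewrite big_split/= sumrN -mulr_suml p1 mul1r subrr.
have gE (z : {ffun 'I_n -> A}) :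
    n%:R^-1 * (\sum_i f (z i)) - mu = n%:R^-1 * \sum_i g (z i).
  rewrite /g big_split/= sumr_const card_ord mulrDr mulNrn mulrN; congr (_ - _).
  by rewrite -[mu *+ n]mulr_natl mulrA mulVf ?mul1r// gt_eqF.
(* Centring makes the cross terms vanish, so of the n^2 products only the n squares survive. *)
have var : \sum_(z : {ffun 'I_n -> A}) iid p z * (\sum_i g (z i)) ^+ 2
    = n%:R * \sum_a p a * g a ^+ 2.
  transitivity (\sum_(i < n) \sum_(j < n) \sum_(z : {ffun 'I_n -> A})
                  iid p z * (g (z i) * g (z j))).
    under [RHS]eq_bigr => i _ do rewrite exchange_big/=.
    rewrite [RHS]exchange_big/=; apply: eq_bigr => z _.
    rewrite expr2 big_distrlr/= big_distrr/=; apply: eq_bigr => i _.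
    by rewrite big_distrr.
  rewrite mulr_natl -[in RHS](card_ord n) -sumr_const.
  apply: eq_bigr => i _; rewrite (bigD1 i)//= [X in _ + X]big1 ?addr0.
    rewrite -(sum_iid_coord i (fun a => g a ^+ 2) p1).
    by apply: eq_bigr => z _; rewrite expr2.
  move=> j ji; rewrite /iid (sum_iid_coord2 (fun a b => g a * g b) p1) 1?eq_sym//.
  rewrite (eq_bigr (fun a => p a * g a * \sum_b p b * g b)).
    by rewrite gsum; apply: big1 => a _; rewrite mulr0.
  by move=> a _; rewrite big_distrr/=; apply: eq_bigr => b _; ring.
(* Markov's inequality for the square below: it is at least 1 on the event and nonnegative off
   it. *)
have -> : n%:R^-1 * (eta ^- 2 * \sum_a p a * (f a - mu) ^+ 2)
   = \sum_(z : {ffun 'I_n -> A}) iid p z * (eta^-1 * (n%:R^-1 * \sum_i g (z i))) ^+ 2.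
  under [RHS]eq_bigr do rewrite mulrA exprMn mulrCA.
  rewrite -mulr_sumr var /g; field.
  by rewrite !gt_eqF.
rewrite big_mkcond/=; apply: ler_sum => z _; case: ifPn => [|_].
  rewrite gE => lt; rewrite ler_peMr ?iid_ge0//.
  rewrite -real_normK ?num_real// expr_ge1// normrM gtr0_norm ?invr_gt0//.
  by rewrite ler_pdivlMl// mulr1 ltW.
by rewrite mulr_ge0 ?iid_ge0// sqr_ge0.
Qed.

End Products.

(** * Method of types *)

Section Types.
Context {R : realType} {A B : finType}.

Definition joint_count n (x : {ffun 'I_n -> A}) (y : {ffun 'I_n -> B}) a b : nat :=
  (\sum_(i < n) ((x i == a) && (y i == b)))%N.

Definition joint_type n (x : {ffun 'I_n -> A}) (y : {ffun 'I_n -> B}) : A -> B -> R :=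
  fun a b => n%:R^-1 * (joint_count x y a b)%:R.

(** The divergence of [J] from [P] times the second marginal of [J]; it is the mutual information
    once the first marginal is [P]. The first marginal of a type is only close to [P], which is why
    [P] stays in the formula. *)
Definition rel_entropy (P : A -> R) (J : A -> B -> R) : R :=
  \sum_a \sum_b J a b * ln (J a b / (P a * marginal2 J b)).

Lemma sum_joint_type n (x : {ffun 'I_n -> A}) (y : {ffun 'I_n -> B}) (f : A -> B -> R) :
  \sum_a \sum_b joint_type x y a b * f a b = n%:R^-1 * \sum_i f (x i) (y i).
Proof.
under eq_bigr => a _ do under eq_bigr => b _ do
  rewrite -mulrA natr_sum mulr_suml.
under eq_bigr do rewrite -mulr_sumr exchange_big/=.
rewrite -mulr_sumr exchange_big/=; congr (_ * _); apply: eq_bigr => i _.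
rewrite -(sum_indic (x i) (fun a => f a (y i))); apply: eq_bigr => a _.
rewrite -(sum_indic (y i) (fun b => f a b)) mulr_sumr; apply: eq_bigr => b _.
by rewrite mulrA -natrM mulnb.
Qed.

Lemma joint_type_ge0 n (x : {ffun 'I_n -> A}) (y : {ffun 'I_n -> B}) a b :
  0 <= joint_type x y a b.
Proof. by rewrite mulr_ge0// ?invr_ge0. Qed.

Lemma joint_type_neq0 n (x : {ffun 'I_n -> A}) (y : {ffun 'I_n -> B}) a b :
  joint_type x y a b != 0 -> exists i, x i = a /\ y i = b.
Proof.
rewrite mulf_eq0 negb_or => /andP[_]; rewrite pnatr_eq0 sum_nat_eq0.
rewrite negb_forall => /existsP[i]/=; rewrite eqb0 negbK => /andP[/eqP ? /eqP ?].
by exists i.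
Qed.

Lemma joint_type_gt0 n (x : {ffun 'I_n -> A}) (y : {ffun 'I_n -> B}) i :
  0 < joint_type x y (x i) (y i).
Proof.
rewrite mulr_gt0 ?invr_gt0 ?ltr0n//; first by case: n {x y} i => [[]|].
by rewrite /joint_count (bigD1 i)//= !eqxx.
Qed.

Lemma joint_count_le n (x : {ffun 'I_n -> A}) (y : {ffun 'I_n -> B}) a b :
  (joint_count x y a b < n.+1)%N.
Proof.
rewrite ltnS -[leqRHS]card_ord -sum1_card; apply: leq_sum => i _.
by rewrite leq_b1.
Qed.

(** The conditional law of the A-letter given the B-letter, read off a table of counts. An empty
    column divides by zero and yields 0, so the masses sum to at most 1. The tables with entries in
    ['I_n.+1] are what the union bound counts. *)
Let cond_count n (N : {ffun A * B -> 'I_n.+1}) a b : R :=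
  (N (a, b))%:R / \sum_a' (N (a', b))%:R.

Let cond_count_ge0 n (N : {ffun A * B -> 'I_n.+1}) a b : 0 <= cond_count N a b.
Proof. by rewrite divr_ge0// sumr_ge0. Qed.

Let sum_cond_count_le1 n (N : {ffun A * B -> 'I_n.+1}) b :
  \sum_a cond_count N a b <= 1.
Proof.
rewrite -mulr_suml; have [->|h] := eqVneq (\sum_i (N (i, b))%:R : R) 0.
  by rewrite mul0r ler01.
by rewrite divff.
Qed.

(* Comparing [iid P] with the kernel given by the conditional type costs exactly
   [expR (- n D)]; a union bound over the types does the rest. *)
Lemma iid_type_bound (P : A -> R) n (y : {ffun 'I_n -> B})
    (S : pred {ffun 'I_n -> A}) (r : R) : is_pmf P ->
  (forall x, S x -> 0 < iid P x -> r <= rel_entropy P (joint_type x y)) ->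
  \sum_(x | S x) iid P x <= n.+1%:R ^+ (#|A| * #|B|) * expR (- (n%:R * r)).
Proof.
move=> [P0 P1] hS.
pose Nx (x : {ffun 'I_n -> A}) : {ffun A * B -> 'I_n.+1} :=
  [ffun ab => Ordinal (joint_count_le x y ab.1 ab.2)].
have bound x : S x -> iid P x <=
    expR (- (n%:R * r)) * \prod_i cond_count (Nx x) (x i) (y i).
  move=> Sx; have := iid_ge0 x P0; rewrite le_eqVlt => /orP[/eqP <-|Px].
    by rewrite mulr_ge0 ?expR_ge0// prodr_ge0.
  have Pxi i : 0 < P (x i).
    rewrite lt0r P0 andbT; apply: contraTneq Px => Pi0.
    by rewrite /iid (bigD1 i)//= Pi0 mul0r ltxx.
  have cE i : cond_count (Nx x) (x i) (y i) =
     joint_type x y (x i) (y i) / marginal2 (joint_type x y) (y i).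
    have n0 : n%:R != 0 :> R by rewrite pnatr_eq0 -lt0n (leq_ltn_trans _ (ltn_ord i)).
    rewrite /cond_count /marginal2 /joint_type -mulr_sumr invfM invrK mulrACA.
    rewrite mulVf// mul1r ffunE/=; congr (_ / _).
    by apply: eq_bigr => a _; rewrite ffunE.
  have m0 i : 0 < marginal2 (joint_type x y) (y i).
    rewrite /marginal2 (bigD1 (x i))//= ltr_pwDl// ?joint_type_gt0//.
    by apply: sumr_ge0 => a _; apply: joint_type_ge0.
  have nD : n%:R * rel_entropy P (joint_type x y) =
      \sum_i ln (cond_count (Nx x) (x i) (y i) / P (x i)).
    rewrite /rel_entropy (sum_joint_type x y (fun a b =>
      ln (joint_type x y a b / (P a * marginal2 (joint_type x y) b)))).
    rewrite mulrA; case: (posnP n) => n0.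
      by rewrite !big1 ?mulr0// => -[i i0]; exfalso; move: i0; rewrite n0.
    rewrite mulfV ?mul1r ?pnatr_eq0 -?lt0n//; apply: eq_bigr => i _; congr ln.
    by rewrite cE invfM mulrA mulrAC.
  have : expR (n%:R * r) <= \prod_i (cond_count (Nx x) (x i) (y i) / P (x i)).
    have -> : \prod_i (cond_count (Nx x) (x i) (y i) / P (x i)) =
        expR (n%:R * rel_entropy P (joint_type x y)).
      rewrite nD expR_sum; apply: eq_bigr => i _; rewrite lnK// posrE.
      by rewrite divr_gt0// cE divr_gt0// joint_type_gt0.
    by rewrite ler_expR ler_wpM2l// hS.
  rewrite big_split/= prodfV -/(iid P x) ler_pdivlMr// => h.
  by rewrite expRN mulrC ler_pdivlMr ?expR_gt0// mulrC.
(* The table of [x] varies with [x]; summing over all tables fixes [N], and then the product kernel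
   has total mass at most 1. *)
apply: (@le_trans _ _ (\sum_(x : {ffun 'I_n -> A}) \sum_(N : {ffun A * B -> 'I_n.+1})
    expR (- (n%:R * r)) * \prod_i cond_count N (x i) (y i))).
  rewrite big_mkcond/=; apply: ler_sum => x _; case: ifPn => [Sx|_].
    apply: le_trans (bound x Sx) _; rewrite (bigD1 (Nx x))//= lerDl.
    by apply: sumr_ge0 => N _; rewrite mulr_ge0 ?expR_ge0// prodr_ge0.
  by apply: sumr_ge0 => N _; rewrite mulr_ge0 ?expR_ge0// prodr_ge0.
rewrite exchange_big/= -natrX -[in X in _ <= X%:R * _](card_ord n.+1) -card_prod.
rewrite -card_ffun -sumr_const mulr_suml; apply: ler_sum => N _.
rewrite mul1r -mulr_sumr ler_piMr ?expR_ge0//.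
rewrite -(bigA_distr_bigA (fun i a => cond_count N a (y i))).
apply: (@le_trans _ _ (\prod_(i < n) 1)); last by rewrite big1.
by apply: ler_prod => i _; rewrite sumr_ge0/=.
Qed.

End Types.

(** * Stability of the rate under relaxed constraints *)

Section Compactness.
Context {R : realType}.

(** [ln] is 0 on nonpositive reals, so only the right limit at 0 needs an estimate: with z = s^2,
    the bound -ln s <= 1/s gives |z ln z| <= 2 s. *)
Lemma continuous_xlnx : continuous (fun x : R => x * ln x).
Proof.
move=> x; have [x0|x0|->] := ltgtP x 0.
- apply: (@near_cst_continuous _ _ 0); near=> z; rewrite ln0 ?mulr0//.
  by apply: ltW; near: z; exact: lt_nbhsl.
- by apply: cvgM; [exact: cvg_id|exact: continuous_ln].
rewrite /continuous_at mul0r; apply/cvgr0Pnorm_le => e e0; near=> z.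
have [z0|z0] := leP z 0; first by rewrite ln0// mulr0 normr0 ltW.
have zs : z = Num.sqrt z ^+ 2 by rewrite sqr_sqrtr// ltW.
have s0 : 0 < Num.sqrt z by rewrite sqrtr_gt0.
have z1 : z < 1 by near: z; exact: lt_nbhsl.
rewrite ler0_norm; last by rewrite mulr_ge0_le0 ?ln_le0// ltW.
have : - ln (Num.sqrt z) <= (Num.sqrt z)^-1.
  by rewrite -lnV ?posrE// ltW// ln_sublinear ?invr_gt0.
rewrite -(ler_pM2l s0) mulfV ?gt_eqF// => h.
rewrite {2}zs lnXn// {1}zs -mulr_natl.
apply: (@le_trans _ _ (2 * Num.sqrt z)); first by nra.
have : z < (e / 2) ^+ 2 by near: z; apply: lt_nbhsl; rewrite exprn_gt0// divr_gt0.
have e20 : 0 <= e / 2 by rewrite divr_ge0// ltW.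
rewrite {1}zs ltr_pXn2r ?nnegrE ?sqrtr_ge0 // => ?; lra.
Unshelve. all: by end_near. Qed.

Lemma continuous_sumr (T : topologicalType) (I : finType) (F : I -> T -> R) :
  (forall i, continuous (F i)) -> continuous (fun x => \sum_i F i x).
Proof.
by move=> cF; apply: continuous_big => //; exact: add_continuous.
Qed.

Let continuous_addr (T : topologicalType) (f g : T -> R) :
  continuous f -> continuous g -> continuous (fun x => f x + g x).
Proof. by move=> cf cg x; apply: cvgD; [exact: cf|exact: cg]. Qed.

Let continuous_subr (T : topologicalType) (f g : T -> R) :
  continuous f -> continuous g -> continuous (fun x => f x - g x).
Proof. by move=> cf cg x; apply: cvgB; [exact: cf|exact: cg]. Qed.

Let continuous_mulr (T : topologicalType) (f : T -> R) (c : R) :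
  continuous f -> continuous (fun x => f x * c).
Proof. by move=> cf x; apply: cvgMl; exact: cf. Qed.

Let continuous_norm (T : topologicalType) (f : T -> R) :
  continuous f -> continuous (fun x => `|f x|).
Proof. by move=> cf x; apply: cvg_norm; exact: cf. Qed.

Let continuous_cst (T : topologicalType) (c : R) : continuous (fun _ : T => c).
Proof. by move=> x; exact: cvg_cst. Qed.

(** Twice the positive part: a continuous penalty that vanishes exactly when [t <= 0]. *)
Let pos (t : R) := t + `|t|.

Let pos_ge0 t : 0 <= pos t.
Proof. by rewrite /pos; case: (ger0P t) => *; lra. Qed.

Let pos_le t u : 0 <= u -> t <= u -> pos t <= u + u.
Proof. by rewrite /pos; case: (ger0P t) => *; lra. Qed.

Let pos_le0 t : pos t <= 0 -> t <= 0.
Proof. by rewrite /pos; case: (ger0P t) => *; lra. Qed.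

Let continuous_pos (T : topologicalType) (f : T -> R) :
  continuous f -> continuous (fun x => pos (f x)).
Proof. by move=> cf x; apply: cvgD; [exact: cf|apply: cvg_norm; exact: cf]. Qed.

(** Splitting the logarithm leaves only linear terms and terms x ln x, which are continuous up to
    the boundary of the simplex. Absolute continuity with respect to [P] makes the split legitimate
    wherever [J a b] is positive. *)
Lemma rel_entropyE (A B : finType) (P : A -> R) (J : A -> B -> R) :
  (forall a, 0 <= P a) -> (forall a b, 0 <= J a b) ->
  (forall a b, P a = 0 -> J a b = 0) ->
  rel_entropy P J = \sum_a \sum_b (J a b * ln (J a b) - J a b * ln (P a))
    - \sum_b marginal2 J b * ln (marginal2 J b).
Proof.
move=> P0 J0 PJ.
have -> : \sum_b marginal2 J b * ln (marginal2 J b) =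
    \sum_a \sum_b J a b * ln (marginal2 J b).
  by rewrite exchange_big/=; apply: eq_bigr => b _; rewrite mulr_suml.
rewrite -sumrB; apply: eq_bigr => a _; rewrite -sumrB; apply: eq_bigr => b _.
have [->|Jab] := eqVneq (J a b) 0; first by rewrite !mul0r !subr0.
have Jab0 : 0 < J a b by rewrite lt0r Jab J0.
have Pa0 : 0 < P a.
  by rewrite lt0r P0 andbT; apply: contra Jab => /eqP /PJ ->.
have m0 : 0 < marginal2 J b.
  by rewrite /marginal2 (bigD1 a)//= ltr_pwDl// sumr_ge0.
by rewrite ln_div ?posrE ?mulr_gt0// lnM ?posrE//; ring.
Qed.

Lemma mutual_info_joint (A B : finType) (P : A -> R) (V : A -> B -> R) :
  is_cond_pmf V -> mutual_info (joint P V) = rel_entropy P (joint P V).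
Proof.
move=> hV; apply: eq_bigr => a _; apply: eq_bigr => b _.
suff -> : marginal1 (joint P V) a = P a by [].
by rewrite /marginal1 /joint -mulr_sumr; have [_ ->] := hV a; rewrite mulr1.
Qed.

(* The violation [v] of the constraints together with [rel_entropy P J <= s] is
   continuous and positive on a cube, hence bounded away from 0. *)
Lemma rel_entropy_gap (A B : finType) (P : A -> R) (W q : A -> B -> R) (s : R) :
  is_pmf P -> is_cond_pmf W ->
  (forall V, is_cond_pmf V ->
    (forall b, marginal2 (joint P V) b = marginal2 (joint P W) b) ->
    expectation2 (joint P W) q <= expectation2 (joint P V) q ->
    s < mutual_info (joint P V)) ->
  exists2 eta : R, 0 < eta & forall J : A -> B -> R,
    (forall a b, 0 <= J a b) -> \sum_a \sum_b J a b = 1 ->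
    (forall a b, P a = 0 -> J a b = 0) ->
    (forall a, `|marginal1 J a - P a| <= eta) ->
    (forall b, `|marginal2 J b - marginal2 (joint P W) b| <= eta) ->
    expectation2 (joint P W) q - eta <= expectation2 J q ->
    s < rel_entropy P J.
Proof.
move=> [P0 P1] hW hs.
(* Pointwise convergence is the product topology, so the cube [K] below is compact by Tychonoff. *)
pose T := {ptws A * B -> R}; pose jt (x : T) a b := x (a, b).
pose D (x : T) := \sum_a \sum_b (jt x a b * ln (jt x a b) - jt x a b * ln (P a))
    - \sum_b marginal2 (jt x) b * ln (marginal2 (jt x) b).
pose v (x : T) := \sum_a `|marginal1 (jt x) a - P a|
  + \sum_b `|marginal2 (jt x) b - marginal2 (joint P W) b|
  + pos (expectation2 (joint P W) q - expectation2 (jt x) q) + pos (D x - s).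
have cjt a b : continuous (fun x => jt x a b) by exact: proj_continuous.
have cm1 a : continuous (fun x => marginal1 (jt x) a).
  by apply: continuous_sumr => b.
have cm2 b : continuous (fun x => marginal2 (jt x) b).
  by apply: continuous_sumr => a.
have cxl (f : T -> R) : continuous f -> continuous (fun x => f x * ln (f x)).
  move=> cf x; apply: (@continuous_comp _ _ _ f (fun t => t * ln t)); first exact: cf.
  exact: continuous_xlnx.
have cD : continuous D.
  rewrite /D; apply: continuous_subr.
    apply: continuous_sumr => a; apply: continuous_sumr => b.
    by apply: continuous_subr; [exact: cxl|exact: continuous_mulr].
  by apply: continuous_sumr => b; exact: cxl.
have cE : continuous (fun x => expectation2 (jt x) q).
  apply: continuous_sumr => a; apply: continuous_sumr => b.
  exact: continuous_mulr.
have cv : continuous v.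
  rewrite /v; apply: continuous_addr;
    [apply: continuous_addr; [apply: continuous_addr|]|].
  - apply: continuous_sumr => a; apply: continuous_norm; apply: continuous_subr => //.
  - apply: continuous_sumr => b; apply: continuous_norm; apply: continuous_subr => //.
  - by apply: continuous_pos; apply: continuous_subr.
  - by apply: continuous_pos; apply: continuous_subr.
pose K := [set x : T | forall ab, x ab \in `[0, 1]].
have cK : compact K.
  apply: (@tychonoff _ (fun=> R) (fun=> [set t | t \in `[0, 1]])) => _.
  exact: segment_compact.
have v1 (x : T) : 0 <= \sum_a `|marginal1 (jt x) a - P a| by exact: sumr_ge0.
have v2 (x : T) : 0 <= \sum_b `|marginal2 (jt x) b - marginal2 (joint P W) b|.
  exact: sumr_ge0.
have v3 (x : T) := pos_ge0 (expectation2 (joint P W) q - expectation2 (jt x) q).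
have v4 (x : T) := pos_ge0 (D x - s).
have DE (x : T) : K x -> (forall a b, P a = 0 -> jt x a b = 0) ->
    rel_entropy P (jt x) = D x.
  move=> Kx hx; rewrite /D rel_entropyE// => a b.
  by have := Kx (a, b); rewrite in_itv => /andP[].
(* A zero of [v] would be a feasible joint law of divergence at most [s], against [hs]. *)
have v0 (x : T) : K x -> 0 < v x.
  move=> Kx; rewrite ltNge; apply/negP => vx.
  have x0 a b : 0 <= jt x a b by have := Kx (a, b); rewrite in_itv => /andP[].
  have e1 : \sum_a `|marginal1 (jt x) a - P a| <= 0.
    by move: vx (v1 x) (v2 x) (v3 x) (v4 x); rewrite /v; lra.
  have e2 : \sum_b `|marginal2 (jt x) b - marginal2 (joint P W) b| <= 0.
    by move: vx (v1 x) (v2 x) (v3 x) (v4 x); rewrite /v; lra.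
  have e3 : expectation2 (joint P W) q - expectation2 (jt x) q <= 0.
    by apply: pos_le0; move: vx (v1 x) (v2 x) (v3 x) (v4 x); rewrite /v; lra.
  have e4 : D x - s <= 0.
    by apply: pos_le0; move: vx (v1 x) (v2 x) (v3 x) (v4 x); rewrite /v; lra.
  have m1 a : marginal1 (jt x) a = P a.
    apply/eqP; rewrite -subr_eq0 -normr_le0; apply: le_trans e1.
    by rewrite (bigD1 a)//= lerDl sumr_ge0.
  have m2 b : marginal2 (jt x) b = marginal2 (joint P W) b.
    apply/eqP; rewrite -subr_eq0 -normr_le0; apply: le_trans e2.
    by rewrite (bigD1 b)//= lerDl sumr_ge0.
  have xP a b : P a = 0 -> jt x a b = 0.
    rewrite -m1 => /eqP; rewrite /marginal1 psumr_eq0// => /allP/(_ b).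
    by rewrite mem_index_enum => /(_ isT)/eqP.
  (* Disintegrate the joint law; where [P a] vanishes any conditional law will do, and [W a] is
     one. *)
  pose V a b := if P a == 0 then W a b else jt x a b / P a.
  have VE : joint P V = jt x.
    apply/funext => a; apply/funext => b; rewrite /joint /V.
    have [Pa|Pa] := eqVneq (P a) 0; first by rewrite Pa mul0r xP.
    by rewrite mulrCA mulfV// mulr1.
  have hV : is_cond_pmf V.
    move=> a; rewrite /V; have [Pa|Pa] := eqVneq (P a) 0; first exact: hW.
    split=> [b|]; first by rewrite divr_ge0.
    by rewrite -mulr_suml -/(marginal1 (jt x) a) m1 mulfV.
  have := hs V hV; rewrite mutual_info_joint// VE DE// => /(_ m2).
  by rewrite -subr_le0 => /(_ e3); move: e4; lra.
have [K0|K0] := pselect (K !=set0); last first.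
  by exists 1 => // J J0 J1 _ _ _ _; exfalso; apply: K0; exists (fun=> 0) => ab;
    rewrite in_itv/= lexx ler01.
have [x /set_mem Kx xmin] := compact_EVT_min K0 cK (continuous_subspaceT cv).
(* If every constraint is off by at most eta and [D] is at most [s], then [v] is at most (#|A| +
   #|B| + 2) eta, the 2 coming from [pos]; one further eta keeps this strictly below the minimum. *)
pose c : R := #|A|%:R + #|B|%:R + 3.
have c0 : 0 < c by rewrite /c ltr_wpDl// addr_ge0.
exists (v x / c) => [|J J0 J1 JP h1 h2 h3]; first by rewrite divr_gt0// v0.
have eta0 : 0 < v x / c by rewrite divr_gt0// v0.
pose y : T := fun ab => J ab.1 ab.2.
have yE : jt y = J by apply/funext => a; apply/funext => b.
have Ky : K y.
  move=> [a b]; rewrite in_itv/= J0/= -J1 (bigD1 a)//= (bigD1 b)//= -addrA lerDl.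
  by rewrite addr_ge0// ?sumr_ge0// => a' _; rewrite sumr_ge0.
rewrite -yE DE ?yE// ltNge; apply/negP => Ds.
have := xmin y (mem_set Ky); rewrite [v y]/v yE; apply/negP; rewrite -ltNge.
have s1 : \sum_a `|marginal1 J a - P a| <= #|A|%:R * (v x / c).
  by rewrite mulr_natl -sumr_const; apply: ler_sum => a _.
have s2 : \sum_b `|marginal2 J b - marginal2 (joint P W) b| <= #|B|%:R * (v x / c).
  by rewrite mulr_natl -sumr_const; apply: ler_sum => b _.
have s3 : pos (expectation2 (joint P W) q - expectation2 J q) <= v x / c + v x / c.
  by apply: pos_le; [exact: ltW|move: h3; lra].
have s4 : pos (D y - s) <= 0 + 0 by apply: pos_le => //; lra.
have : v x = c * (v x / c) by rewrite mulrCA mulfV ?mulr1 ?gt_eqF.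
move: eta0 s1 s2 s3 s4; rewrite /c; set w := v x / _ => *; nra.
Qed.

End Compactness.

(** * Random coding *)

Section RandomCoding.
Context {R : realType}.

Lemma exists_le_mean (T : finType) (p f : T -> R) (b : R) :
  is_pmf p -> \sum_t p t * f t <= b -> exists t, f t <= b.
Proof.
move=> [p0 p1] fb; apply: contrapT => /forallNP h.
have lt t : 0 < f t - b by rewrite subr_gt0 ltNge; apply/negP/h.
have ge t : 0 <= p t * (f t - b) by rewrite mulr_ge0// ltW.
have : \sum_t p t * (f t - b) <= 0.
  under eq_bigr do rewrite mulrBr.
  by rewrite sumrB -mulr_suml p1 mul1r subr_le0.
move=> s0; have /eqP : \sum_t p t * (f t - b) = 0.
  by apply/eqP; rewrite eq_le s0 sumr_ge0.
rewrite psumr_eq0// => /allP z.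
have : \sum_t p t = 0.
  apply: big1 => t _; have := z t (mem_index_enum t).
  by rewrite mulf_eq0 (gt_eqF (lt t)) orbF => /eqP.
by rewrite p1 => /eqP; rewrite oner_eq0.
Qed.

(** Some rival comes within the margin of the sent word. No decoder appears, so a union bound over
    rivals applies directly. *)
Definition margin_error (X Y : finType) M (d : X -> Y -> R) (c : 'I_M -> X)
    (delta : R) (m : 'I_M) (y : Y) : bool :=
  [exists j, (j != m) && (d (c m) y < d (c j) y + delta)].

Definition error_rate (X Y : finType) M (W d : X -> Y -> R) (c : 'I_M -> X)
    (delta : R) : R :=
  M%:R^-1 * \sum_m \sum_(y | margin_error d c delta m y) W (c m) y.

(** Average over codebooks of independent words of law [Q]. Pairs outside [G] are written off as
    errors; inside [G] each of the [M] rivals confuses with probability at most [e]. Some codebook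
    is no worse than the average. *)
Lemma random_coding (X Y : finType) M (Q : X -> R) (W d : X -> Y -> R)
    (delta e : R) (G : X -> Y -> bool) :
  is_pmf Q -> is_cond_pmf W -> 0 <= e ->
  (forall x y, G x y -> \sum_(x' | d x y < d x' y + delta) Q x' <= e) ->
  exists c : 'I_M.+1 -> X, error_rate W d c delta <=
    \sum_x \sum_(y | ~~ G x y) Q x * W x y + M%:R * e.
Proof.
move=> hQ hW e0 hG; have [Q0 Q1] := hQ.
have W0 x y : 0 <= W x y by have [+ _] := hW x.
have [c hc] : exists c : {ffun 'I_M.+1 -> X}, error_rate W d c delta <=
    \sum_x \sum_(y | ~~ G x y) Q x * W x y + M%:R * e; last by exists c.
apply: exists_le_mean (is_pmf_iid M.+1 hQ) _.
pose bad (x : X) y := (~~ G x y)%:R * W x y.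
pose confuse (x x' : X) y := (G x y && (d x y < d x' y + delta))%:R * W x y.
have step (c : {ffun 'I_M.+1 -> X}) m :
    \sum_(y | margin_error d c delta m y) W (c m) y <=
    \sum_y bad (c m) y + \sum_(j | j != m) \sum_y confuse (c m) (c j) y.
  rewrite exchange_big/= -big_split/= big_mkcond/=; apply: ler_sum => y _.
  have cf0 j : 0 <= confuse (c m) (c j) y by rewrite mulr_ge0.
  case: ifPn => [/existsP[j /andP[jm lt]]|_]; last first.
    by rewrite addr_ge0 ?sumr_ge0// mulr_ge0.
  have [Gmy|Gmy] := boolP (G (c m) y); last first.
    by rewrite {1}/bad Gmy mul1r lerDl sumr_ge0.
  rewrite /bad Gmy mul0r add0r (bigD1 j)//= {1}/confuse Gmy lt mul1r lerDl.
  by rewrite sumr_ge0.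
have mean m : \sum_(c : {ffun 'I_M.+1 -> X}) iid Q c *
      (\sum_(y | margin_error d c delta m y) W (c m) y) <=
    \sum_x \sum_(y | ~~ G x y) Q x * W x y + M%:R * e.
  apply: (@le_trans _ _ (\sum_(c : {ffun 'I_M.+1 -> X}) iid Q c *
      (\sum_y bad (c m) y + \sum_(j | j != m) \sum_y confuse (c m) (c j) y))).
    by apply: ler_sum => c _; rewrite ler_wpM2l ?iid_ge0.
  under eq_bigr do rewrite mulrDr [X in _ + X]mulr_sumr.
  rewrite big_split/=; apply: lerD.
    rewrite /iid (sum_iid_coord m (fun x => \sum_y bad x y) Q1).
    apply: ler_sum => x _; rewrite mulr_sumr [leRHS]big_mkcond/=.
    by apply: ler_sum => y _; rewrite /bad; case: ifP => _; rewrite (mul1r, mul0r) ?mulr0.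
  rewrite exchange_big/=.
  have -> : M%:R * e = \sum_(j | j != m) e.
    by rewrite sumr_const cardC1 card_ord mulr_natl.
  apply: ler_sum => j jm.
  rewrite /iid (sum_iid_coord2 (fun x x' => \sum_y confuse x x' y) Q1) 1?eq_sym//.
  apply: (@le_trans _ _ (\sum_x \sum_y Q x * W x y * e)); last first.
    rewrite -[leRHS]mul1r -Q1 mulr_suml; apply: ler_sum => x _.
    by rewrite -mulr_suml -mulr_sumr; have [_ ->] := hW x; rewrite mulr1.
  apply: ler_sum => x _; under eq_bigr do rewrite mulr_sumr.
  rewrite exchange_big/=; apply: ler_sum => y _.
  have [Gxy|Gxy] := boolP (G x y); last first.
    rewrite big1 ?mulr_ge0// => x' _.
    by rewrite /confuse (negbTE Gxy) mul0r mulr0.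
  apply: le_trans (ler_wpM2l (mulr_ge0 (Q0 x) (W0 x y)) (hG x y Gxy)).
  rewrite mulr_sumr [leRHS]big_mkcond/=; apply: ler_sum => x' _.
  rewrite /confuse Gxy/=; case: ifP => _; last by rewrite mul0r mulr0.
  by rewrite mul1r mulrAC.
have -> : \sum_(c : {ffun 'I_M.+1 -> X}) iid Q c * error_rate W d c delta =
    M.+1%:R^-1 * \sum_m \sum_(c : {ffun 'I_M.+1 -> X}) iid Q c *
      \sum_(y | margin_error d c delta m y) W (c m) y.
  rewrite exchange_big mulr_sumr; apply: eq_bigr => c _.
  by rewrite mulrCA mulr_sumr.
rewrite ler_pdivrMl ?ltr0n//.
apply: (@le_trans _ _ (\sum_(m < M.+1)
   (\sum_x \sum_(y | ~~ G x y) Q x * W x y + M%:R * e))); first exact: ler_sum.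
by rewrite sumr_const card_ord [leRHS]mulr_natl.
Qed.

Lemma lln_iid (A I : finType) (p : A -> R) (f : I -> A -> R) (eta : R) :
  is_pmf p -> 0 < eta -> exists K : R, forall n, (0 < n)%N ->
  \sum_(z : {ffun 'I_n -> A}
     | [exists i, eta < `|n%:R^-1 * (\sum_l f i (z l)) - \sum_a p a * f i a|])
    iid p z <= n%:R^-1 * K.
Proof.
move=> hp eta0.
exists (\sum_i eta ^- 2 * \sum_a p a * (f i a - \sum_b p b * f i b) ^+ 2) => n n0.
rewrite mulr_sumr; apply: le_trans; last first.
  by apply: ler_sum => i _; exact: (chebyshev_iid (f i) hp eta0 n0).
under [leRHS]eq_bigr do rewrite big_mkcond/=.
rewrite [leRHS]exchange_big/= [leLHS]big_mkcond/=; apply: ler_sum => z _.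
have z0 : 0 <= iid p z by apply: iid_ge0; case: hp.
case: ifPn => [/existsP[i hi]|_]; last by apply: sumr_ge0 => i _; case: ifP.
by rewrite (bigD1 i)//= hi lerDl sumr_ge0// => j _; case: ifP.
Qed.

(** The Taylor term of degree [d.+1] of the exponential outgrows the polynomial by one power of n,
    which is the 1/n kept on the right. *)
Lemma poly_expR_bound (d : nat) (k : R) : 0 < k ->
  exists K : R, forall n, (0 < n)%N ->
    n.+1%:R ^+ d * expR (- (n%:R * k)) <= n%:R^-1 * K.
Proof.
move=> k0; exists (2 ^+ d * (d.+1)`!%:R / k ^+ d.+1) => n n0.
have n0R : 0 < n%:R :> R by rewrite ltr0n.
have x0 : 0 < n%:R * k by rewrite mulr_gt0.
have le1 : n.+1%:R ^+ d <= (2 * n%:R) ^+ d :> R.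
  apply: lerXn2r; rewrite ?nnegrE ?mulr_ge0//.
  by rewrite -natrM ler_nat mul2n -addnn -addn1 leq_add2l.
have le2 : (n%:R * k) ^+ d.+1 / (d.+1)`!%:R <= expR (n%:R * k).
  by apply: le_trans (expR_ge1Dxn d (ltW x0)); rewrite lerDr.
rewrite expRN ler_pdivrMr ?expR_gt0//; apply: le_trans le1 _.
apply: le_trans (ler_wpM2l _ le2).
  have f0 : (d.+1)`!%:R != 0 :> R by rewrite gt_eqF// ltr0n fact_gt0.
  have kd0 : k ^+ d.+1 != 0 by rewrite gt_eqF// exprn_gt0.
  rewrite !exprMn [n%:R ^+ d.+1]exprS; move: f0 kd0.
  set f := _%:R; set kd := k ^+ _ => f0 kd0; rewrite le_eqVlt; apply/orP; left.
  by apply/eqP; field; rewrite f0 kd0 gt_eqF.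
by rewrite !mulr_ge0 ?invr_ge0 ?exprn_ge0// ltW.
Qed.

End RandomCoding.

(** * Codes for a memoryless channel from typical random codewords *)

Section BlockCoding.
Context {R : realType}.

Lemma sum_iid_memoryless (A B : finType) (P : A -> R) (W : A -> B -> R) n
    (h : {ffun 'I_n -> A} -> {ffun 'I_n -> B} -> bool) :
  \sum_x \sum_(y | h x y) iid P x * memoryless W x y =
  \sum_(z : {ffun 'I_n -> A * B}
     | h [ffun i => (z i).1] [ffun i => (z i).2])
    iid (fun ab => P ab.1 * W ab.1 ab.2) z.
Proof.
rewrite pair_big_dep/=.
rewrite (reindex (fun z : {ffun 'I_n -> A * B} =>
   ([ffun i => (z i).1] : {ffun 'I_n -> A}, [ffun i => (z i).2] : {ffun 'I_n -> B})))/=.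
  apply: eq_bigr => z _; rewrite /iid /memoryless -big_split/=.
  by apply: eq_bigr => i _; rewrite !ffunE.
exists (fun xy : {ffun 'I_n -> A} * {ffun 'I_n -> B} =>
  [ffun i => (xy.1 i, xy.2 i)]) => [z _|[x y] _].
  by apply/ffunP => i; rewrite !ffunE/=; case: (z i).
by congr pair; apply/ffunP => i; rewrite !ffunE.
Qed.

Lemma is_pmf_joint (A B : finType) (P : A -> R) (W : A -> B -> R) :
  is_pmf P -> is_cond_pmf W -> is_pmf (fun ab : A * B => P ab.1 * W ab.1 ab.2).
Proof.
move=> [P0 P1] hW; split=> [[a b]|].
  by rewrite mulr_ge0//; have [+ _] := hW a.
rewrite -(pair_big xpredT xpredT (fun a b => P a * W a b))/= -P1.
by apply: eq_bigr => a _; rewrite -mulr_sumr; have [_ ->] := hW a; rewrite mulr1.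
Qed.

Lemma block_coding (A B : finType) (P : A -> R) (W q : A -> B -> R) (s r : R) :
  is_pmf P -> is_cond_pmf W -> r < s ->
  (forall V, is_cond_pmf V ->
    (forall b, marginal2 (joint P V) b = marginal2 (joint P W) b) ->
    expectation2 (joint P W) q <= expectation2 (joint P V) q ->
    s < mutual_info (joint P V)) ->
  exists2 delta : R, 0 < delta & exists (K : R) (n0 : nat), forall n, (n0 < n)%N ->
  exists c : 'I_(Num.truncn (expR (n%:R * r))).+1 -> {ffun 'I_n -> A},
    error_rate (@memoryless R A B W n) (@additive_metric R A B q n) c delta
    <= n%:R^-1 * K.
Proof.
move=> hP hW rs hs; have [P0 P1] := hP.
have [eta eta0 gap] := rel_entropy_gap hP hW hs.
have eta20 : 0 < eta / 2 by rewrite divr_gt0.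
pose PW (ab : A * B) := P ab.1 * W ab.1 ab.2.
have hPW : is_pmf PW by exact: is_pmf_joint.
pose Eq := expectation2 (joint P W) q.
pose PY := marginal2 (joint P W).
(* One family of tests for the sent pair: [Some b] measures the frequency of the output letter [b],
   [None] the score. *)
pose f (o : option B) (ab : A * B) : R :=
  if o is Some b then (ab.2 == b)%:R else q ab.1 ab.2.
have [K1 hK1] := lln_iid f hPW eta20.
have [K2 hK2] := lln_iid (fun a a' => (a' == a)%:R) hP eta0.
have sr0 : 0 < s - r by rewrite subr_gt0.
have [K3 hK3] := poly_expR_bound (#|A| * #|B|) sr0.
(* Half of eta is spent on the deviation of the true score, half on the margin. The factors 2 come
   from conditioning on typicality, an event that the threshold on n makes at least 1/2 likely. *)
exists (eta / 2) => //; exists (2 * K1 + 2 * K3), (Num.truncn `|2 * K2|) => n n0.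
have npos : (0 < n)%N by exact: leq_ltn_trans n0.
have nR : 0 < n%:R :> R by rewrite ltr0n.
pose T (x : {ffun 'I_n -> A}) :=
  ~~ [exists a, eta < `|n%:R^-1 * (\sum_i (x i == a)%:R) - \sum_a' P a' * (a' == a)%:R|].
pose G (x : {ffun 'I_n -> A}) (y : {ffun 'I_n -> B}) := ~~ [exists o,
  eta / 2 < `|n%:R^-1 * (\sum_i f o (x i, y i)) - \sum_ab PW ab * f o ab|].
pose Z := \sum_(x | T x) iid P x.
have Zhalf : 1 / 2 <= Z.
  have : \sum_(x | ~~ T x) iid P x <= 1 / 2.
    apply: le_trans (_ : n%:R^-1 * K2 <= _).
      rewrite (eq_bigl _ _ (fun x => negbK _)); exact: hK2.
    rewrite ler_pdivrMl//; have : `|2 * K2| < n%:R.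
      by rewrite -truncn_lt_nat.
    by rewrite ltr_norml => /andP[_ ?]; lra.
  have [_] := is_pmf_iid n hP; rewrite (bigID T)/= -/Z => ? ?; lra.
have Z0 : 0 < Z by apply: lt_le_trans Zhalf.
(* Typicality is imposed on the codewords themselves because the output says nothing about the
   letter frequencies of a rival word. *)
pose Q (x : {ffun 'I_n -> A}) := (T x)%:R * iid P x / Z.
have hQ : is_pmf Q.
  split=> [x|]; first by rewrite divr_ge0 ?mulr_ge0 ?iid_ge0// ltW.
  rewrite -mulr_suml; have -> : \sum_x (T x)%:R * iid P x = Z.
    rewrite /Z [RHS]big_mkcond/=; apply: eq_bigr => x _.
    by case: (T x); rewrite (mul1r, mul0r).
  by rewrite mulfV ?gt_eqF.
have QP x : Q x <= 2 * ((T x)%:R * iid P x).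
  rewrite mulrC; apply: ler_wpM2l; first by rewrite mulr_ge0 ?iid_ge0.
  by rewrite -[leRHS]invrK lef_pV2 ?posrE// ?invr_gt0//; lra.
have hWn := is_cond_pmf_memoryless (n := n) hW.
have PYE b : \sum_ab PW ab * f (Some b) ab = PY b.
  rewrite -(pair_big xpredT xpredT (fun a b' => P a * W a b' * (b' == b)%:R))/=.
  apply: eq_bigr => a _; rewrite -[RHS](sum_indic b (fun b => P a * W a b)).
  by apply: eq_bigr => b' _; rewrite mulrC eq_sym.
have EqE : \sum_ab PW ab * f None ab = Eq.
  by rewrite -(pair_big xpredT xpredT (fun a b => P a * W a b * q a b)).
pose e := 2 * (n.+1%:R ^+ (#|A| * #|B|) * expR (- (n%:R * s))).
have e0 : 0 <= e by rewrite !mulr_ge0 ?exprn_ge0 ?expR_ge0.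
have [|c hc] := @random_coding R _ _ (Num.truncn (expR (n%:R * r))) Q
  (@memoryless R A B W n) (@additive_metric R A B q n) (eta / 2) e G hQ hWn e0.
  move=> x y /existsPn Gxy.
  apply: (@le_trans _ _ (2 * \sum_(x' | T x' &&
     (additive_metric q x y < additive_metric q x' y + eta / 2)) iid P x')).
    rewrite mulr_sumr [leLHS]big_mkcond [leRHS]big_mkcond/=; apply: ler_sum => x' _.
    case: ifP => lt; last by rewrite andbF.
    by apply: le_trans (QP x') _; case: (T x'); rewrite ?(mul1r, mul0r, mulr0).
  rewrite ler_wpM2l//; apply: iid_type_bound => // x' /andP[Tx' lt] Px'.
  pose J : A -> B -> R := joint_type x' y.
  have sumJ (g : A -> B -> R) : \sum_a \sum_b J a b * g a b = _ :=
    sum_joint_type x' y g.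
  apply/ltW/(gap J).
  - exact: joint_type_ge0.
  - transitivity (\sum_a \sum_b J a b * 1).
      by apply: eq_bigr => a _; apply: eq_bigr => b _; rewrite mulr1.
    by rewrite (sumJ (fun _ _ => 1)) sumr_const card_ord mulVf// gt_eqF.
  - move=> a b Pa; apply/eqP; apply: contraTT Px' => /joint_type_neq0[i [xi _]].
    by rewrite /iid (bigD1 i)//= xi Pa mul0r ltxx.
  - move=> a; have /existsPn/(_ a) := Tx'; rewrite -leNgt.
    rewrite (eq_bigr (fun a' => (a == a')%:R * P a')); last first.
      by move=> a' _; rewrite mulrC eq_sym.
    rewrite sum_indic; congr (`|_ - _| <= _).
    rewrite -(sumJ (fun a' _ => (a' == a)%:R)) -[RHS](sum_indic a).
    apply: eq_bigr => a' _; rewrite mulr_sumr; apply: eq_bigr => b _.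
    by rewrite mulrC eq_sym.
  - move=> b; have := Gxy (Some b); rewrite -leNgt PYE => h.
    apply: le_trans (_ : eta / 2 <= _); last by lra.
    suff -> : marginal2 J b = n%:R^-1 * \sum_i (y i == b)%:R by [].
    rewrite -(sumJ (fun _ b' => (b' == b)%:R)); apply: eq_bigr => a _.
    rewrite -[LHS](sum_indic b); apply: eq_bigr => b' _.
    by rewrite mulrC eq_sym.
  (* The rival scores more than the sent word minus eta/2, and the sent word scores at least [Eq]
     minus eta/2. *)
  - have := Gxy None; rewrite -leNgt EqE ler_norml => /andP[h _].
    rewrite /expectation2 sumJ -/(expectation2 _ _) -/Eq.
    move: lt h; rewrite /additive_metric /f/=.
    set u := _ * _; set v := n%:R^-1 * _; lra.
exists c; apply: le_trans hc _; rewrite mulrDr; apply: lerD.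
  apply: (@le_trans _ _ (2 * \sum_x \sum_(y | ~~ G x y) iid P x * memoryless W x y)).
    rewrite mulr_sumr; apply: ler_sum => x _; rewrite mulr_sumr.
    apply: ler_sum => y _; rewrite mulrA ler_wpM2r//; first by have [+ _] := hWn x.
    apply: le_trans (QP x) _; rewrite ler_wpM2l//.
    by case: (T x); rewrite ?mul1r// mul0r iid_ge0.
  rewrite mulrCA ler_wpM2l// sum_iid_memoryless.
  apply: le_trans (hK1 n npos); rewrite le_eqVlt; apply/orP; left; apply/eqP.
  apply: eq_bigl => z; rewrite negbK; apply: eq_existsb => o.
  congr (_ < `|_ * _ - _|); apply: eq_bigr => i _; rewrite !ffunE.
  by case: (z i).
(* At most exp(n r) rivals, each confusing with probability at most [e], which is exp(-n s) up to a
   polynomial: the product decays since [r < s]. *)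
have tr : (Num.truncn (expR (n%:R * r)))%:R <= expR (n%:R * r).
  by have /andP[] := truncn_itv (expR_ge0 (n%:R * r)).
apply: le_trans (ler_wpM2r e0 tr) _; rewrite /e mulrCA [leRHS]mulrCA ler_wpM2l//.
apply: le_trans (hK3 n npos); rewrite mulrCA ler_wpM2l ?exprn_ge0//.
by rewrite -expRD ler_expR; lra.
Qed.

End BlockCoding.

(** * Padding to arbitrary block lengths *)

Section Padding.
Context {R : realType} {X Y : finType}.

Lemma big_injective (T S : finType) (U : Type) (idx : U) (op : Monoid.com_law idx)
    (e : T -> S) (F : S -> U) : injective e ->
  \big[op/idx]_s F s =
  op (\big[op/idx]_t F (e t)) (\big[op/idx]_(s | s \notin e @: predT) F s).
Proof.
move=> inje; rewrite (bigID (fun s => s \in e @: predT))/=; congr (op _ _).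
rewrite big_imset/=; last by move=> ? ? _ _; exact: inje.
by apply: eq_bigl => t; rewrite inE.
Qed.

Variables (N m k : nat) (e : 'I_m * 'I_k -> 'I_N) (inje : injective e).

(** Blocks are placed along the injection [e]; the positions it misses carry the letter [x0] in
    every codeword. *)
Definition pad (x0 : X) (x : {ffun 'I_m -> {ffun 'I_k -> X}}) : {ffun 'I_N -> X} :=
  [ffun s => if [pick t | e t == s] is Some t then x t.1 t.2 else x0].

Definition unpad (y : {ffun 'I_N -> Y}) : {ffun 'I_m -> {ffun 'I_k -> Y}} :=
  [ffun i => [ffun j => y (e (i, j))]].

Lemma pick_injective t : [pick t' | e t' == e t] = Some t.
Proof.
by case: pickP => [t' /eqP/inje ->|/(_ t)] //; rewrite eqxx.
Qed.

Lemma pad_in x0 x t : pad x0 x (e t) = x t.1 t.2.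
Proof. by rewrite ffunE pick_injective. Qed.

Lemma pick_notin s : s \notin e @: predT -> [pick t | e t == s] = None.
Proof.
by case: pickP => // t /eqP <-; rewrite imset_f.
Qed.

Lemma pad_out x0 x s : s \notin e @: predT -> pad x0 x s = x0.
Proof. by move=> h; rewrite ffunE pick_notin. Qed.

(** The last sum does not depend on [x], so it cancels whenever two codewords are compared. *)
Lemma additive_metric_pad (q : X -> Y -> R) x0 x (y : {ffun 'I_N -> Y}) :
  (0 < m)%N -> (0 < k)%N ->
  additive_metric q (pad x0 x) y = N%:R^-1 *
    ((m * k)%:R * additive_metric (@additive_metric R X Y q k) x (unpad y)
     + \sum_(s | s \notin e @: predT) q x0 (y s)).
Proof.
move=> m0 k0; rewrite /additive_metric (big_injective _ _ inje)/=; congr (_ * (_ + _)).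
  rewrite natrM mulrACA mulfV ?pnatr_eq0 -?lt0n// mul1r -mulr_sumr mulrA.
  rewrite mulfV ?mul1r ?pnatr_eq0 -?lt0n// pair_big/=.
  by apply: eq_bigr => -[i j] _; rewrite pad_in !ffunE.
by apply: eq_bigr => s h; rewrite pad_out.
Qed.

Lemma sum_memoryless_pad (W : X -> Y -> R) x0 x
    (h : pred {ffun 'I_m -> {ffun 'I_k -> Y}}) :
  is_cond_pmf W ->
  \sum_(y | h (unpad y)) memoryless W (pad x0 x) y =
  \sum_(y | h y) memoryless (@memoryless R X Y W k) x y.
Proof.
move=> hW; rewrite (partition_big unpad h)//=; apply: eq_bigr => y hy.
(* The fibre of [unpad] over [y] is a product of constraints, one per position, so the sum factors;
   the free positions sum to 1. *)
pose Q s := [pred b | if [pick t | e t == s] is Some t then b == y t.1 t.2 else true].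
transitivity (\sum_(z in family Q) \prod_s W (pad x0 x s) (z s)).
  apply: eq_bigl => z; apply/andP/familyP => [[_ /eqP zy] s|zQ].
    rewrite inE; case: pickP => // t /eqP <-.
    by rewrite -zy !ffunE -surjective_pairing.
  suff -> : unpad z = y by rewrite hy eqxx.
  apply/ffunP => i; apply/ffunP => j; rewrite !ffunE.
  by have := zQ (e (i, j)); rewrite unfold_in/= pick_injective => /eqP.
rewrite -(bigA_distr_big_dep _ (fun s b => W (pad x0 x s) b)).
rewrite (big_injective _ _ inje)/= [X in _ * X]big1 ?mulr1; last first.
  move=> s hs; rewrite pad_out// (eq_bigl xpredT); first by have [_ ->] := hW x0.
  by move=> b; rewrite /Q/= pick_notin.
rewrite /memoryless pair_big/=; apply: eq_bigr => -[i j] _; rewrite pad_in/=.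
by rewrite (eq_bigl (pred1 (y i j))) ?big_pred1_eq// => b; rewrite /Q/= pick_injective.
Qed.

(** Unnormalised score differences are unchanged by padding, so a margin carries over after
    rescaling by the lengths. *)
Lemma error_rate_pad (W q : X -> Y -> R) x0 M delta delta'
    (c : 'I_M -> {ffun 'I_m -> {ffun 'I_k -> X}}) :
  is_cond_pmf W -> (0 < m)%N -> (0 < k)%N -> N%:R * delta' <= (m * k)%:R * delta ->
  error_rate (@memoryless R X Y W N) (@additive_metric R X Y q N)
     (fun i => pad x0 (c i)) delta' <=
  error_rate (@memoryless R _ _ (@memoryless R X Y W k) m)
     (@additive_metric R _ _ (@additive_metric R X Y q k) m) c delta.
Proof.
move=> hW m0 k0 hd; rewrite ler_wpM2l ?invr_ge0//; apply: ler_sum => i _.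
rewrite -(sum_memoryless_pad x0 _ (margin_error _ c delta i))//.
rewrite big_mkcond [leRHS]big_mkcond/=; apply: ler_sum => y _.
have W0 : 0 <= memoryless W (pad x0 (c i)) y.
  by apply: prodr_ge0 => s _; have [+ _] := hW (pad x0 (c i) s).
case: ifPn => [/existsP[j /andP[ji lt]]|_]; last by case: ifP.
rewrite ifT//; apply/existsP; exists j; rewrite ji/=.
have N0 : 0 < N%:R :> R.
  by rewrite ltr0n (leq_ltn_trans _ (ltn_ord (e (Ordinal m0, Ordinal k0)))).
have mk0 : 0 < (m * k)%:R :> R by rewrite ltr0n muln_gt0 m0.
have N0' : N%:R != 0 :> R by rewrite gt_eqF.
rewrite -(ltr_pM2l mk0) mulrDr.
rewrite !additive_metric_pad// -(ltr_pM2l N0) [ltRHS]mulrDr !mulVKf// in lt.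
by move: lt hd; lra.
Qed.

End Padding.

(** * Converse *)

Section Converse.
Context {R : realType}.

(** A Donsker-Varadhan bound: [t] tilts the product of the marginals, and allowing a total mass of 2
    rather than 1 costs ln 2. *)
Lemma mutual_info_lower (A B : finType) (J t : A -> B -> R) :
  (forall a b, 0 <= J a b) -> \sum_a \sum_b J a b = 1 ->
  (forall a b, 0 < t a b) ->
  \sum_a \sum_b marginal1 J a * marginal2 J b * t a b <= 2 ->
  \sum_a \sum_b J a b * ln (t a b) - ln 2 <= mutual_info J.
Proof.
move=> J0 J1 t0 Z2.
have pt a b : J a b * ln (t a b) - J a b * ln 2 + J a b
    - 2^-1 * (marginal1 J a * marginal2 J b * t a b)
    <= J a b * ln (J a b / (marginal1 J a * marginal2 J b)).
  have [->|Jab] := eqVneq (J a b) 0.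
    rewrite !mul0r subr0 !add0r oppr_le0 !mulr_ge0 ?sumr_ge0// ?invr_ge0//.
    exact: ltW.
  have Jp : 0 < J a b by rewrite lt0r Jab J0.
  have m1 : 0 < marginal1 J a by rewrite /marginal1 (bigD1 b)//= ltr_pwDl// sumr_ge0.
  have m2 : 0 < marginal2 J b by rewrite /marginal2 (bigD1 a)//= ltr_pwDl// sumr_ge0.
  set Q := marginal1 J a * marginal2 J b; have Q0 : 0 < Q by rewrite mulr_gt0.
  (* Pointwise ln u <= u - 1, with [u] the density of half the tilted product with respect to
     [J]. *)
  pose u := Q * t a b / (2 * J a b).
  have u0 : 0 < u by rewrite divr_gt0// mulr_gt0.
  have : J a b * ln u <= 2^-1 * (Q * t a b) - J a b.
    have -> : 2^-1 * (Q * t a b) - J a b = J a b * (u - 1).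
      by rewrite /u; field.
    rewrite ler_pM2l// -[X in ln X](subrKC 1) le_ln1Dx// ltrBrDr addrC subrr//.
  rewrite /u !ln_div ?posrE ?mulr_gt0// !lnM ?posrE// => h.
  by move: h; lra.
apply: le_trans (_ : \sum_a \sum_b (J a b * ln (t a b) - J a b * ln 2 + J a b
    - 2^-1 * (marginal1 J a * marginal2 J b * t a b)) <= _); last first.
  by apply: ler_sum => a _; apply: ler_sum => b _; exact: pt.
under [leRHS]eq_bigr do rewrite sumrB big_split/= sumrB -mulr_suml -mulr_sumr.
rewrite sumrB big_split/= sumrB -mulr_suml -mulr_sumr J1.
lra.
Qed.

Lemma margin_decoderP (X Y : finType) n M (d : {ffun 'I_n -> X} -> {ffun 'I_n -> Y} -> R)
    (c : 'I_M -> {ffun 'I_n -> X}) delta y i j :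
  margin_decoder d c delta y = Some i -> j != i -> d (c j) y + delta <= d (c i) y.
Proof.
rewrite /margin_decoder; case: pickP => // k /forallP h [<-] ji.
by have /implyP := h j; apply.
Qed.

Lemma fano_margin (X Y : finType) n M (W d : {ffun 'I_n -> X} -> {ffun 'I_n -> Y} -> R)
    (V : {ffun 'I_n -> X} -> {ffun 'I_n -> Y} -> R)
    (c : 'I_M -> {ffun 'I_n -> X}) (delta eps B : R) :
  let P x := M%:R^-1 * \sum_m (c m == x)%:R in
  (0 < M)%N -> 0 < delta -> 0 <= B -> is_cond_pmf W -> is_cond_pmf V ->
  (forall x y, `|d x y| <= B) ->
  (forall y, marginal2 (joint P V) y = marginal2 (joint P W) y) ->
  expectation2 (joint P W) d <= expectation2 (joint P V) d ->
  P_margin W c d delta <= eps ->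
  (1 - (eps + 2 * B * eps / delta)) * ln M%:R - ln 2 <= mutual_info (joint P V).
Proof.
move=> P M0 d0 B0 hW hV hB hm he hP.
have MR : 0 < M%:R :> R by rewrite ltr0n.
have M1 : 1 <= M%:R :> R by rewrite ler1n.
have sumP (F : {ffun 'I_n -> X} -> R) : \sum_x P x * F x = M%:R^-1 * \sum_m F (c m).
  under eq_bigr do rewrite -mulrA mulr_suml.
  rewrite -mulr_sumr exchange_big/=; congr (_ * _); apply: eq_bigr => m _.
  exact: sum_indic.
have sumJ (U : {ffun 'I_n -> X} -> {ffun 'I_n -> Y} -> R) h :
    \sum_x \sum_y joint P U x y * h x y = M%:R^-1 * \sum_m \sum_y U (c m) y * h (c m) y.
  rewrite -(sumP (fun x => \sum_y U x y * h x y)); apply: eq_bigr => x _.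
  by rewrite mulr_sumr; apply: eq_bigr => y _; rewrite mulrA.
have sumY U h : \sum_x \sum_y joint P U x y * h y = \sum_y marginal2 (joint P U) y * h y.
  by rewrite exchange_big/=; apply: eq_bigr => y _; rewrite mulr_suml.
have sumVW h : \sum_x \sum_y joint P V x y * h y = \sum_x \sum_y joint P W x y * h y.
  by rewrite !sumY; apply: eq_bigr => y _; rewrite hm.
have P0 x : 0 <= P x by rewrite mulr_ge0 ?invr_ge0 ?sumr_ge0.
have P1 : \sum_x P x = 1.
  under eq_bigr do rewrite -[P _]mulr1.
  by rewrite (sumP (fun=> 1)) sumr_const card_ord mulVf ?gt_eqF.
have V0 x y : 0 <= V x y by have [+ _] := hV x.
have W0 x y : 0 <= W x y by have [+ _] := hW x.
have J0 x y : 0 <= joint P V x y by rewrite mulr_ge0.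
have J1 : \sum_x \sum_y joint P V x y = 1.
  rewrite -P1; apply: eq_bigr => x _; rewrite -mulr_sumr.
  by have [_ ->] := hV x; rewrite mulr1.
pose dec := margin_decoder d c delta.
pose ok x y := if dec y is Some i then c i == x else false.
(* The score of the decoded word, or the ceiling [B] if there is none. It is a function of [y]
   alone, so its mean is the same under [V] and [W]. *)
pose g y := if dec y is Some i then d (c i) y else B.
have dB x y : d x y <= B by have := hB x y; rewrite ler_norml => /andP[].
have dBN x y : - B <= d x y by have := hB x y; rewrite ler_norml => /andP[].
(* A correctly decoded pair attains [g] exactly; an error costs at most 2 B. *)
have Wlow : expectation2 (joint P W) d >=
    \sum_x \sum_y joint P W x y * g y - 2 * B * P_margin W c d delta.
  rewrite /expectation2 !sumJ /P_margin mulrCA -mulrBr ler_pM2l ?invr_gt0//.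
  rewrite mulr_sumr -sumrB; apply: ler_sum => m _.
  rewrite mulr_sumr [X in _ - X]big_mkcond/= -sumrB; apply: ler_sum => y _.
  rewrite -/dec /g; case: ifPn => [_|/negPn/eqP ->]; last by rewrite subr0.
  rewrite [_ * W _ _]mulrC -mulrBr ler_wpM2l//; have := dBN (c m) y.
  by case: (dec y) => [i|]; [have := dB (c i) y|]; lra.
(* [g] dominates the score, and exceeds it by at least delta when another word is decoded. *)
have Vup : expectation2 (joint P V) d <=
    \sum_x \sum_y joint P V x y * g y -
    delta * \sum_x \sum_y joint P V x y * ((dec y != None) && ~~ ok x y)%:R.
  rewrite /expectation2 (sumJ V) (sumJ V (fun _ => g)).
  rewrite (sumJ V (fun x y => ((dec y != None) && ~~ ok x y)%:R)).
  rewrite mulrCA -mulrBr ler_pM2l ?invr_gt0// mulr_sumr -sumrB; apply: ler_sum => m _.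
  rewrite mulr_sumr -sumrB; apply: ler_sum => y _.
  rewrite mulrCA -mulrBr ler_wpM2l// /g /ok.
  case E : (dec y) => [i|]/=; last by rewrite mulr0 subr0.
  have [->|im] := eqVneq i m; first by rewrite eqxx mulr0 subr0.
  have := margin_decoderP E (_ : m != i); rewrite eq_sym => /(_ im).
  by case: eqP => [->|_]; rewrite /= ?mulr0 ?mulr1 ?subr0; lra.
have bad1 : \sum_x \sum_y joint P V x y * ((dec y != None) && ~~ ok x y)%:R <=
    2 * B * eps / delta.
  rewrite ler_pdivlMr// mulrC.
  have : 2 * B * P_margin W c d delta <= 2 * B * eps by rewrite ler_wpM2l// mulr_ge0.
  by move: he Wlow Vup; rewrite sumVW; lra.
have bad2 : \sum_x \sum_y joint P V x y * (dec y == None)%:R <= eps.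
  rewrite sumVW sumJ; apply: le_trans hP; rewrite ler_pM2l ?invr_gt0//.
  apply: ler_sum => m _; rewrite [leRHS]big_mkcond/=; apply: ler_sum => y _.
  rewrite -/dec; case: eqP => [->|_]/=; first by rewrite mulr1.
  by rewrite mulr0; case: ifP.
have good : 1 - (eps + 2 * B * eps / delta) <= \sum_x \sum_y joint P V x y * (ok x y)%:R.
  have : \sum_x \sum_y joint P V x y * (ok x y)%:R =
    \sum_x \sum_y joint P V x y
   - \sum_x \sum_y joint P V x y * (dec y == None)%:R
   - \sum_x \sum_y joint P V x y * ((dec y != None) && ~~ ok x y)%:R.
    rewrite -!sumrB; apply: eq_bigr => x _; rewrite -!sumrB; apply: eq_bigr => y _.
    rewrite /ok; case: (dec y) => [i|]/=; [case: eqP => _|];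
      by rewrite /= ?mulr0 ?mulr1 ?subr0 ?subrr.
  by move=> ->; rewrite J1; move: bad1 bad2; lra.
(* Given [y], the decoded word has [P]-mass 1/M, so weighting it by [M] adds only 1 to the mass of
   the other words, which is at most 1. *)
pose t x y := if ok x y then M%:R else 1 : R.
apply: le_trans (_ : \sum_x \sum_y joint P V x y * ln (t x y) - ln 2 <= _).
  rewrite lerB// (le_trans (ler_wpM2r (ln_ge0 M1) good))// mulr_suml.
  apply: ler_sum => x _; rewrite mulr_suml; apply: ler_sum => y _.
  by rewrite /t; case: (ok x y); rewrite ?mulr1// ln1 mulr0 mul0r.
apply: mutual_info_lower => // [x y|].
  by rewrite /t; case: ifP.
have mP x : marginal1 (joint P V) x = P x.
  by rewrite /marginal1 -mulr_sumr; have [_ ->] := hV x; rewrite mulr1.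
have m0 y : 0 <= marginal2 (joint P V) y by exact: sumr_ge0.
have m1 : \sum_y marginal2 (joint P V) y = 1 by rewrite exchange_big.
rewrite exchange_big/=.
apply: (@le_trans _ _ (\sum_y marginal2 (joint P V) y * 2)); last first.
  by rewrite -mulr_suml m1 mul1r.
apply: ler_sum => y _.
rewrite (eq_bigr (fun x => marginal2 (joint P V) y * (P x * t x y))); last first.
  by move=> x _; rewrite mP; ring.
rewrite -mulr_sumr ler_wpM2l// sumP /t /ok.
case E : (dec y) => [i|]; last first.
  by rewrite sumr_const card_ord mulVf ?gt_eqF// ler1n.
rewrite ler_pdivrMl// (bigD1 i)//= eqxx.
apply: (@le_trans _ _ (M%:R + \sum_(m < M | m != i) 1)).
  (* A second index carrying the decoded word would have to trail itself by delta. *)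
  rewrite lerD2l; apply: ler_sum => m mi; case: eqP => // cim.
  by have := margin_decoderP E mi; rewrite cim; lra.
apply: (@le_trans _ _ (M%:R + \sum_(m < M) 1)).
  by rewrite lerD2l [leRHS](bigID (fun m => m != i))/= lerDl sumr_ge0.
by rewrite sumr_const card_ord; lra.
Qed.

End Converse.

(** * Capacity *)

Section Capacity.
Context {R : realType} {X Y : finType}.

(** If the sent message beats all rivals by the margin, the decoder can pick no other: two winners
    would beat each other by a positive amount. *)
Lemma P_margin_le_error_rate n M (W d : {ffun 'I_n -> X} -> {ffun 'I_n -> Y} -> R)
    (c : 'I_M -> {ffun 'I_n -> X}) (delta : R) :
  0 < delta -> is_cond_pmf W -> P_margin W c d delta <= error_rate W d c delta.
Proof.
move=> d0 hW; rewrite ler_wpM2l ?invr_ge0//; apply: ler_sum => m _.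
rewrite big_mkcond [leRHS]big_mkcond/=; apply: ler_sum => y _.
have W0 : 0 <= W (c m) y by have [+ _] := hW (c m).
case: ifPn => [dec|_]; last by case: ifP.
rewrite ifT//; apply: contraNT dec => /existsPn h.
have hm j : j != m -> d (c j) y + delta <= d (c m) y.
  by move=> jm; have := h j; rewrite jm/= -leNgt.
rewrite /margin_decoder; case: pickP => [i /forallP hi|/(_ m)/negbT/negP[]]; last first.
  by apply/forallP => j; apply/implyP; exact: hm.
have [->//|im] := eqVneq i m.
by have := hm i im; have := hi m; rewrite eq_sym im/=; lra.
Qed.

Lemma product_rate_achievable (W q : X -> Y -> R) (k : nat) (r : R) :
  is_cond_pmf W -> (0 < k)%N -> (r%:E < product_rate W q k)%E ->
  exists2 delta : R, 0 < delta & forall eps : R, 0 < eps < 1 ->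
    achievable_margin W q delta eps r.
Proof.
move=> hW k0 /ereal_sup_gt[_ [P hP <-]] lt.
have kR : 0 < k%:R :> R by rewrite ltr0n.
(* The room between [r] and the infimum provides [s]; an infimum of +oo would leave no feasible
   [V]. *)
have [s rs hs] : exists2 s : R, r < s & forall V, feasible W q P V ->
    s < k%:R^-1 * mutual_info (joint P V).
  have infP V : feasible W q P V ->
      (ereal_inf [set (k%:R^-1 * mutual_info (joint P V))%:E
        | V in [set V | feasible W q P V]] <= (k%:R^-1 * mutual_info (joint P V))%:E)%E.
    by move=> hV; apply: ereal_inf_lbound; exists V.
  move: lt infP; case: (ereal_inf _) => [i| |]//.
    rewrite lte_fin => ri infP; exists ((r + i) / 2); first lra.
    by move=> V /infP; rewrite lee_fin; lra.
  by move=> _ infP; exists (r + 1) => [|V /infP]; [lra|rewrite leye_eq].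
(* The mass of [P] on blocks of positive length supplies a letter to pad with. *)
have [x0] : exists x : X, True.
  have [x _|] := pickP (@predT {ffun 'I_k -> X}); first by exists (x (Ordinal k0)).
  move=> e; case: hP => _; rewrite big1 => [/eqP|x _]; first by rewrite eq_sym oner_eq0.
  by have := e x.
move=> _.
have hWk := is_cond_pmf_memoryless (n := k) hW.
have rsk : k%:R * r < k%:R * s by rewrite ltr_pM2l.
have [|delta delta0 [K [n0 hK]]] :=
    block_coding (q := @additive_metric R X Y q k) hP hWk rsk.
  by move=> V hV h1 h2; rewrite -ltr_pdivlMl// hs.
(* As soon as one block fits, N is at most twice the length covered by blocks, so padding shrinks
   the margin by at most a factor 2. *)
exists (delta / 2) => [|eps /andP[eps0 _] gamma gamma0]; first by rewrite divr_gt0.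
pose M N := (Num.truncn (expR ((N %/ k)%:R * (k%:R * r)))).+1.
have code N : exists c : 'I_(M N) -> {ffun 'I_N -> X}, (n0 < N %/ k)%N ->
    P_margin (@memoryless R X Y W N) c (@additive_metric R X Y q N) (delta / 2)
    <= (N %/ k)%:R^-1 * K.
  have [m0|] := ltnP n0 (N %/ k); last by exists (fun=> [ffun=> x0]).
  have [c hc] := hK _ m0.
  have cardN : (#|{: 'I_(N %/ k) * 'I_k}| <= N)%N.
    by rewrite card_prod !card_ord leq_divM.
  pose e (t : 'I_(N %/ k) * 'I_k) : 'I_N := widen_ord cardN (enum_rank t).
  have inje : injective e.
    by move=> t u /(congr1 val)/= /val_inj/enum_rank_inj.
  have mpos : (0 < N %/ k)%N by exact: leq_ltn_trans m0.
  exists (fun i => pad e x0 (c i)) => _; apply: le_trans hc.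
  apply: le_trans (P_margin_le_error_rate _ _ _ _) _; first by rewrite divr_gt0.
    exact: is_cond_pmf_memoryless.
  apply: error_rate_pad => //; rewrite mulrA mulrAC ler_pM2r//.
  rewrite ler_pdivrMr// -natrM ler_nat.
  rewrite {1}(divn_eq N k) muln2 -addnn leq_add2l.
  by rewrite (leq_trans (ltnW (ltn_pmod N k0)))// leq_pmull.
exists M, (fun N => projT1 (cid (code N))).
pose n1 := (maxn n0 (Num.truncn (`|K| / eps))).+1.
(* The first summand provides enough blocks for the error bound; the second keeps the rate lost to
   the fewer than k leftover letters below gamma. *)
exists (n1 * k + (Num.truncn (k%:R * `|r| / gamma)).+1)%N => // N /= hN.
have m1 : (n1 <= N %/ k)%N by rewrite leq_divRL// (leq_trans _ hN)// leq_addr.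
have n01 : (n0 < N %/ k)%N by apply: leq_trans m1; rewrite ltnS leq_maxl.
have mpos : (0 < N %/ k)%N by exact: leq_ltn_trans n01.
have mR : 0 < (N %/ k)%:R :> R by rewrite ltr0n.
have NR : 0 < N%:R :> R by rewrite ltr0n (leq_trans mpos)// leq_div.
split=> //; last first.
  apply: le_trans (projT2 (cid (code N)) n01) _; rewrite ler_pdivrMl// -ler_pdivrMr//.
  apply: le_trans (_ : `|K| / eps <= _).
    by rewrite ler_wpM2r ?invr_ge0 ?ler_norm// ltW.
  apply: ltW; rewrite -truncn_lt_nat ?divr_ge0 ?(ltW eps0)//.
  by apply: leq_trans m1; rewrite ltnS leq_maxr.
have lnM : (N %/ k)%:R * (k%:R * r) <= ln (M N)%:R.
  by rewrite -ler_expR lnK ?posrE ?ltr0n// ltW// truncnS_gt.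
rewrite ler_pdivlMl//; apply: le_trans lnM.
have Nlow : k%:R * `|r| <= gamma * N%:R.
  rewrite [leRHS]mulrC -ler_pdivrMr// ltW// -truncn_lt_nat; last first.
    by rewrite divr_ge0 ?mulr_ge0// ltW.
  by apply: leq_trans hN; rewrite leq_addl.
have Neq : N%:R = (N %/ k)%:R * k%:R + (N %% k)%:R :> R.
  by rewrite -natrM -natrD -divn_eq.
have tk : (N %% k)%:R * r <= k%:R * `|r|.
  apply: (@le_trans _ _ ((N %% k)%:R * `|r|)); first by rewrite ler_wpM2l// ler_norm.
  by rewrite ler_wpM2r// ler_nat ltnW// ltn_pmod.
have h : N%:R * r <= (N %/ k)%:R * (k%:R * r) + k%:R * `|r|.
  by rewrite [in leLHS]Neq mulrDl -mulrA lerD2l.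
rewrite mulrBr [N%:R * gamma]mulrC lerBlDr; apply: le_trans h _.
by rewrite lerD2l.
Qed.

Lemma achievable_le_product_rate (W q : X -> Y -> R) (delta r : R) :
  is_cond_pmf W -> 0 < delta ->
  (forall eps : R, 0 < eps < 1 -> achievable_margin W q delta eps r) ->
  (r%:E <= product_rate_infty W q)%E.
Proof.
move=> hW delta0 hr.
pose B : R := \sum_x \sum_y `|q x y|.
have B0 : 0 <= B by apply: sumr_ge0 => x _; exact: sumr_ge0.
have qB x y : `|q x y| <= B.
  rewrite /B (bigD1 x)//= (bigD1 y)//= -addrA lerDl addr_ge0// ?sumr_ge0// => x' _.
  exact: sumr_ge0.
have dB n (x : {ffun 'I_n -> X}) y : `|additive_metric q x y| <= B.
  case: (posnP n) => n0.
    rewrite /additive_metric big1 ?mulr0 ?normr0// => i.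
    by have := ltn_ord i; rewrite [X in (_ < X)%N]n0.
  rewrite normrM ger0_norm ?invr_ge0// ler_pdivrMl ?ltr0n//.
  apply: le_trans (ler_norm_sum _ _ _) _; rewrite mulr_natl -[X in _ *+ X](card_ord n).
  by rewrite -sumr_const; apply: ler_sum.
(* The limsup is an infimum, over eventual sets [U], of suprema, so one length in [U] with value at
   least r - e suffices. *)
apply/ereal_infP => _ [U hU <-]; apply/lee_subgt0Pr => e e0; rewrite -EFinB.
(* The three losses, namely the rate slack, the Fano fraction C eps = e / D of the rate, and ln 2 /
   n, are each held to e / 3. *)
pose C : R := 1 + 2 * B / delta.
have C1 : 1 <= C by rewrite lerDl divr_ge0 ?mulr_ge0// ltW.
have C0 : 0 < C by exact: lt_le_trans C1.
pose D : R := 3 * `|r| + e + 1.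
have r0 : 0 <= `|r| := normr_ge0 r.
have D0 : 0 < D by rewrite /D; lra.
pose eps := e / (C * D).
have eps01 : 0 < eps < 1.
  rewrite /eps divr_gt0 ?mulr_gt0//= ltr_pdivrMr ?mulr_gt0// mul1r.
  apply: (@lt_le_trans _ _ D); first by rewrite /D; lra.
  by rewrite ler_peMl// ltW.
have Ceps : eps + 2 * B * eps / delta = e / D.
  have -> : eps + 2 * B * eps / delta = C * eps by rewrite /C; ring.
  by rewrite /eps mulrCA invfM mulVKf ?gt_eqF.
have e30 : 0 < e / 3 by rewrite divr_gt0.
have [M [c hc]] := hr eps eps01 (e / 3) e30.
have big_n : \forall n \near \oo, 6 / e < n%:R.
  exists (Num.truncn (6 / e)).+1 => // n /= hn.
  by rewrite -truncn_lt_nat// divr_ge0// ltW.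
have [n [[Un [M0 rate err]] nbig]] := filter_ex (filterI (filterI hU hc) big_n).
have nR : 0 < n%:R :> R by apply: lt_trans nbig; rewrite divr_gt0.
apply: le_trans (_ : product_rate W q n <= _)%E; last first.
  by apply: ereal_sup_ubound; exists n.
pose P (x : {ffun 'I_n -> X}) : R := (M n)%:R^-1 * \sum_m (c n m == x)%:R.
have hP : is_pmf P.
  split=> [x|]; first by rewrite mulr_ge0 ?invr_ge0 ?sumr_ge0.
  rewrite -mulr_sumr exchange_big/= (eq_bigr (fun=> 1)).
    by rewrite sumr_const card_ord mulVf// pnatr_eq0 -lt0n.
  move=> m _; rewrite -[RHS](sum_indic (c n m) (fun=> 1)).
  by apply: eq_bigr => x _; rewrite mulr1.
apply: le_trans (ereal_sup_ubound _); last by exists P.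
apply/ereal_infP => _ [V [hV h1 h2] <-]; rewrite lee_fin.
have hWn := is_cond_pmf_memoryless (n := n) hW.
have := fano_margin M0 delta0 B0 hWn hV (@dB n) h1 h2 err.
rewrite Ceps ler_pdivlMl// => fano; apply: le_trans fano.
have eD : 0 <= 1 - e / D by rewrite subr_ge0 ler_pdivrMr// mul1r /D; lra.
have eDr : e / D * r <= e / 3.
  apply: (@le_trans _ _ (e / D * `|r|)).
    by rewrite ler_wpM2l ?ler_norm// divr_ge0// ltW.
  by rewrite mulrAC ler_pdivrMr// -mulrA ler_wpM2l ?(ltW e0)// /D; lra.
have ln2 : ln 2 <= n%:R * (e / 3) :> R.
  apply: le_trans (ltW (ln_sublinear _)) _ => //.
  by move: nbig; rewrite ltr_pdivrMr//; lra.
have lnM : n%:R * (r - e / 3) <= ln (M n)%:R by rewrite -ler_pdivlMl.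
have : (1 - e / D) * (n%:R * (r - e / 3)) <= (1 - e / D) * ln (M n)%:R.
  by rewrite ler_wpM2l.
have : n%:R * (r - e / 3 - e / D * r) <= (1 - e / D) * (n%:R * (r - e / 3)).
  have eD0 : 0 <= e / D by rewrite divr_ge0// ltW.
  have : 0 <= n%:R * (e / D * (e / 3)).
    by rewrite mulr_ge0 ?(ltW nR)// mulr_ge0// ltW.
  by move=> *; nra.
have : n%:R * (e / D * r) <= n%:R * (e / 3) by rewrite ler_wpM2l// ltW.
move: ln2; rewrite -/D; set u := ln _; set v := ln _; set w := e / D.
by move=> *; lra.
Qed.

End Capacity.

Theorem theorem1 (R : realType) (X Y : finType) (W q : X -> Y -> R)
  (hW : is_cond_pmf W)
  (hq : exists B : R, [/\ 0 <= B,
          forall x y, q x y <= B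
        & forall x y, 0 < W x y -> - B <= q x y]) :
  product_rate_infty W q = margin_capacity_const W q.
Proof.
apply/eqP; rewrite eq_le; apply/andP; split.
  (* A limsup is at most the supremum over positive lengths, which leaves out the dummy value at
     0. *)
  apply: le_trans
    (_ : ereal_sup [set product_rate W q k | k in [set k | (0 < k)%N]] <= _)%E.
    by apply: ereal_inf_lbound; exists [set k | (0 < k)%N] => //; exists 1%N.
  apply: ge_ereal_sup => _ [k /= k0 <-].
  (* Achievability covers real rates strictly below the product rate; the extended value is then
     approached from below. *)
  have below r : (r%:E < product_rate W q k)%E -> (r%:E <= margin_capacity_const W q)%E.
    move=> /(product_rate_achievable hW k0)[delta delta0 hr].
    apply: le_trans (_ : margin_capacity W q delta <= _)%E.
      by apply: ereal_sup_ubound; exists r.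
    by apply: ereal_sup_ubound; exists delta.
  move: below; case: (product_rate W q k) => [p| |] below.
  - apply/lee_subgt0Pr => e e0; rewrite -EFinB; apply: below.
    by rewrite lte_fin; lra.
  - by rewrite leye_eq; apply/eqP/eqyP => A A0; apply: below; rewrite ltry.
  - exact: leNye.
apply: ge_ereal_sup => _ [delta /= delta0 <-]; apply: ge_ereal_sup => _ [r /= hr <-].
exact: (achievable_le_product_rate hW delta0 hr).
Qed.
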